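(* Consider the hierarchical sampling setup and supersample construction in the context, with loss $\ell$ taking values in $[0,1]$, and assume the algorithm is a single-round hierarchical aggregation: $W_L^{i_{1:L}}:=\mu_L^{i_{1:L}}$; for $l=L,L-1,\dots,1$, each node $i_{1:l-1}$ outputs $W_{l-1}^{i_{1:l-1}}\sim P_{l-1}\big(\cdot\mid (W_l^{i_{1:l-1},j})_{j=1}^{n_l}\big)$ via an aggregation kernel $P_{l-1}$, independently across nodes given the inputs; the final hypothesis is $W=W_0$. Assume each aggregation kernel at depth $l$ is $\epsilon_l$-differentially private: for any two input tuples $w,w'$ differing in a single coordinate and any measurable set $S$, $P_{l-1}(S\mid w)\le e^{\epsilon_l}P_{l-1}(S\mid w')$. Then $$\mathrm{gen}(P_{W\mid\mu})\le 2\sum_{l=1}^{L}\sqrt{\min\big(\epsilon_l,\ \epsilon_l(e^{\epsilon_l}-1)\big)}.$$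
   Context: Hierarchical sampling setup. Fix integers $L\ge 1$ and $n_1,\dots,n_L\ge 1$; $N_l=\prod_{k=1}^l n_k$. Nodes at depth $l$ are indexed by $i_{1:l}$ with $i_k\in\{1,\dots,n_k\}$. $\mathcal P_L=\mathcal Z$ (data space), $\mathcal P_l$ = probability measures on $\mathcal P_{l+1}$ for $l<L$; meta-distribution $D\in\mathcal P_0$. Tree: $\mu_1^{i_1}$ i.i.d. $D$; for $l\ge2$, conditionally independently $\mu_l^{i_{1:l}}\sim\mu_{l-1}^{i_{1:l-1}}$; leaves are data points in $\mathcal Z$. ''$Z\sim\nu$'' for $\nu\in\mathcal P_l$ means sampling down the chain with fresh randomness to a point of $\mathcal Z$. $\hat L(w,\mu)=\frac1{N_L}\sum_{i_{1:L}}\ell(w,\mu_L^{i_{1:L}})$, $L(w)=\mathbb{E}_{Z\sim D}\ell(w,Z)$, $\mathrm{gen}(P_{W\mid\mu})=\mathbb{E}[L(W)-\hat L(W,\mu)]$. Hypotheses of all layers (and data points) are assumed to live in a common space so that aggregation kernels are well defined. Supersample construction. Independent uniform $U_l^{i_{1:l}}\in\{1,2\}$ for every node. $\tilde\mu_1^{i_1}=(\mu_{1,1}^{i_1},\mu_{1,2}^{i_1})\sim D^{\otimes2}$; for $l\ge2$, $\tilde\mu_l^{i_{1:l}}=(\mu_{l,1}^{i_{1:l}},\mu_{l,2}^{i_{1:l}})$ are two conditionally independent draws from the selected parent $\mu_{l-1,U_{l-1}^{i_{1:l-1}}}^{i_{1:l-1}}$. Selected nodes $\mu_l^{i_{1:l}}:=\mu_{l,U_l^{i_{1:l}}}^{i_{1:l}}$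 form the training tree on which the algorithm runs. *)

(* Defs.v *)
From HB Require Import structures.
From mathcomp Require Import all_boot all_order all_algebra.
From mathcomp Require Import all_classical all_reals all_analysis.

Set Implicit Arguments.
Unset Strict Implicit.
Unset Printing Implicit Defensive.
Import Order.TTheory GRing.Theory Num.Theory.
Import numFieldNormedType.Exports.

Local Open Scope classical_set_scope.
Local Open Scope ring_scope.
Local Open Scope ereal_scope.

(* The chain of spaces.  [Lev R Z k] is the space of "k-fold nested"       *)
(* probability measures over the data space Z:                              *)
(*   Lev 0 = Z,   Lev (k+1) = probability measures on Lev k                  *)
(* equipped with the standard sigma-algebra (generated by the evaluation     *)
(* maps mu |-> mu U, library's [pprobability]).  In the paper's notation,    *)
(* P_l = Lev (L - l); in particular P_L = Z and the meta-distribution        *)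
(* D lives in P_0 = Lev L.                                                   *)
Fixpoint Lev (R : realType) (dZ : measure_display) (Z : measurableType dZ)
    (k : nat) : {d : measure_display & measurableType d} :=
  match k with
  | 0 => existT _ dZ Z
  | k'.+1 => existT _ _ (pprobability (projT2 (Lev R Z k')) R)
  end.

Notation LevT R Z k := (projT2 (@Lev R _ Z k)).

(* "Z ~ nu" for nu in Lev k : sample down the chain with fresh randomness *)
(* to a point of Z; [down k nu f] is the expectation of f(Z).             *)
Fixpoint down (R : realType) (dZ : measure_display) (Z : measurableType dZ)
    (k : nat) : LevT R Z k -> (Z -> \bar R) -> \bar R :=
  match k return LevT R Z k -> (Z -> \bar R) -> \bar R with
  | 0 => fun z f => f z
  | k'.+1 => fun nu f => \int[nu]_c @down R dZ Z k' c f
  end.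

(* Joint law of the hierarchical sampling tree together with the output of  *)
(* the single-round hierarchical aggregation algorithm.                      *)
(* [subtree L n K emb k nu cont] : expectation of [cont leaves W] where the  *)
(* node at depth l = L - k carries the value nu in P_l = Lev k; leaves is   *)
(* the sequence of data points (leaves) of the subtree rooted at that node  *)
(* and W = W_l is the hypothesis output by that node:                        *)
(*  - k = 0 (depth L): nu is a data point z, the leaf list is [:: z] and    *)
(*    W_L = z (embedded in the common hypothesis space H by emb);           *)
(*  - k > 0 (depth l < L): n_{l+1} children are drawn i.i.d. from nu, each  *)
(*    child's subtree is sampled independently (recursively), giving the    *)
(*    outputs W_{l+1}^1, ..., W_{l+1}^{n_{l+1}}, and then                     *)
(*    W_l ~ K_{l+1}( . | (W_{l+1}^j)_j ).                                     *)
(* K l is the aggregation kernel applied to the n_l outputs of the depth-l  *)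
(* nodes (the paper's P_{l-1}).                                              *)
Section Subtree.
Context (R : realType) (dZ dH : measure_display)
  (Z : measurableType dZ) (H : measurableType dH).
Variables (L : nat) (n : nat -> nat)
  (K : forall l : nat, (n l).-tuple H -> pprobability H R) (emb : Z -> H).

Fixpoint subtree (k : nat) : LevT R Z k -> (seq Z -> H -> \bar R) -> \bar R :=
  match k return LevT R Z k -> (seq Z -> H -> \bar R) -> \bar R with
  | 0 => fun z cont => cont [:: z] (emb z)
  | k'.+1 => fun nu cont =>
      let fix children (m : nat) : (seq Z -> m.-tuple H -> \bar R) -> \bar R :=
        match m return (seq Z -> m.-tuple H -> \bar R) -> \bar R with
        | 0 => fun f => f [::] [tuple]
        | m'.+1 => fun f =>
            \int[nu]_c @subtree k' c (fun ls w =>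
               children m' (fun ls' t => f (ls ++ ls') [tuple of w :: t]))
        end in
      children (n (L - k')%N) (fun ls ws => \int[@K (L - k')%N ws]_w cont ls w)
  end.

End Subtree.

Definition Nprod (n : nat -> nat) (l : nat) : nat := \prod_(1 <= k < l.+1) n k.

Definition poprisk (R : realType) (dZ dH : measure_display)
  (Z : measurableType dZ) (H : measurableType dH) (L : nat)
  (D : LevT R Z L) (loss : H -> Z -> R) (w : H) : \bar R :=
  @down R dZ Z L D (fun z => (loss w z)%:E).

Definition emprisk (R : realType) (dZ dH : measure_display)
  (Z : measurableType dZ) (H : measurableType dH) (L : nat) (n : nat -> nat)
  (loss : H -> Z -> R) (w : H) (leaves : seq Z) : R :=
  ((\sum_(z <- leaves) loss w z) / (Nprod n L)%:R)%R.

Definition gen (R : realType) (dZ dH : measure_display)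
  (Z : measurableType dZ) (H : measurableType dH) (L : nat) (n : nat -> nat)
  (K : forall l : nat, (n l).-tuple H -> pprobability H R) (emb : Z -> H)
  (D : LevT R Z L) (loss : H -> Z -> R) : \bar R :=
  @subtree R dZ dH Z H L n K emb L D
    (fun leaves w => @poprisk R dZ dH Z H L D loss w
                     - (@emprisk R dZ dH Z H L n loss w leaves)%:E).

Definition kernel_DP (R : realType) (dH : measure_display)
  (H : measurableType dH) (m : nat) (P : m.-tuple H -> pprobability H R)
  (eps : R) : Prop :=
  forall (w w' : m.-tuple H) (i : 'I_m),
    (forall j : 'I_m, j != i -> tnth w j = tnth w' j) ->
    forall S : set H, measurable S ->
      P w S <= (expR eps)%:E * P w' S.

(* Main.v *)
(* For a nonnegative g, the sum of g(W, z) over the leaves z has expectation at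
   least N_L e^{-(eps_1 + ... + eps_L)} E[g(W, Z')], with Z' a fresh sample from D.
   This multiplicative bound goes by induction from the leaves to the root: the
   values c, c' of a child and of an independent copy can be exchanged, and
   differential privacy of the aggregation at their parent makes the exchange cost
   at most a factor e^{eps_l}, everything above being post-processing.  With g the
   loss, gen = A - B where 0 <= A <= 1 and B >= e^{-s} A, s = eps_1 + ... + eps_L,
   so that gen <= 1 - e^{-s} <= min(1, s). *)
Require Import Defs.
From HB Require Import structures.
From mathcomp Require Import all_boot all_order all_algebra.
From mathcomp Require Import all_classical all_reals all_analysis.
From mathcomp Require Import measurable_realfun lra.
Set Implicit Arguments.
Unset Strict Implicit.
Unset Printing Implicit Defensive.
Import Order.TTheory GRing.Theory Num.Theory.
Local Open Scope classical_set_scope.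
Local Open Scope ring_scope.
Local Open Scope ereal_scope.

(** * Probability kernels *)

(* Nonnegative functions are needed for the main inequality, bounded signed ones
   for the integrand of gen. *)
Definition admissible (R : realType) d (T : measurableType d) (f : T -> \bar R) :=
  measurable_fun [set: T] f /\
  ((forall t, 0 <= f t) \/ exists M : R, forall t, `|f t| <= M%:E).

(** Shifting by the bound [M] turns a bounded signed integrand into a nonnegative one; this is how
    the bounded case of [admissible] is reduced to the nonnegative one below. *)
Lemma bounded_add_ge0 (R : realType) (x : \bar R) (M : R) :
  `|x| <= M%:E -> 0 <= x + M%:E.
Proof.
case: x => [x| |]//=; rewrite -EFinD !lee_fin ler_norml => /andP[+ _].
by rewrite -[in X in _ -> X](subrr M) [in X in _ -> X]addrC lerD2r.
Qed.

Lemma integrable_bounded (R : realType) d (T : measurableType d)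
    (P : {measure set T -> \bar R}) (f : T -> \bar R) (M : R) :
  P [set: T] = 1 -> measurable_fun [set: T] f ->
  (forall t, `|f t| <= M%:E) -> P.-integrable [set: T] f.
Proof.
move=> P1 mf fM; apply/integrableP; split => //.
rewrite (@le_lt_trans _ _ (\int[P]_(t in [set: T]) M%:E))//.
  by apply: ge0_le_integral => //; exact: measurableT_comp.
by rewrite integral_cst// P1 mule1 ltry.
Qed.

Lemma integral_add_cst (R : realType) d (T : measurableType d)
    (P : {measure set T -> \bar R}) (f : T -> \bar R) (M c : R) :
  P [set: T] = 1 -> measurable_fun [set: T] f ->
  (forall t, `|f t| <= M%:E) ->
  \int[P]_t (f t + c%:E) = \int[P]_t f t + c%:E.
Proof.
move=> P1 mf fM; rewrite integralD//.
- by rewrite integral_cst// P1 mule1.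
- exact: integrable_bounded fM.
- exact: (@integrable_bounded _ _ _ _ _ `|c|%R).
Qed.

Lemma le_integral_bounded (R : realType) d (T : measurableType d)
    (P : {measure set T -> \bar R}) (f : T -> \bar R) (M : R) :
  P [set: T] = 1 -> measurable_fun [set: T] f ->
  (forall t, `|f t| <= M%:E) -> `|\int[P]_t f t| <= M%:E.
Proof.
move=> P1 mf fM; apply: (@le_trans _ _ (\int[P]_t `|f t|)); first exact: le_abse_integral.
rewrite -[leRHS]mule1 -P1 -integral_cst//.
by apply: ge0_le_integral => //; exact: measurableT_comp.
Qed.

Lemma measurable_pker_integral (R : realType) d1 d2 (X : measurableType d1)
    (Y : measurableType d2) (l : R.-pker X ~> Y) (f : X * Y -> \bar R) :
  (forall p, 0 <= f p) -> measurable_fun [set: X * Y] f ->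
  measurable_fun [set: X] (fun x => \int[l x]_y f (x, y)).
Proof. by move=> f0 mf; exact: measurable_fun_integral_finite_kernel. Qed.

Lemma admissible_integral (R : realType) d1 d2 (X : measurableType d1)
    (Y : measurableType d2) (l : R.-pker X ~> Y) (f : X * Y -> \bar R) :
  admissible f -> admissible (fun x => \int[l x]_y f (x, y)).
Proof.
move=> [mf [f0|[M fM]]].
  split; first exact: measurable_pker_integral.
  by left => x; apply: integral_ge0.
have mfx x : measurable_fun [set: Y] (fun y => f (x, y)).
  exact: measurableT_comp.
split.
  have fE x : \int[l x]_y f (x, y) = \int[l x]_y (f (x, y) + M%:E) - M%:E.
    by rewrite (@integral_add_cst _ _ _ _ _ M) ?prob_kernel ?addeK.
  under eq_fun do rewrite fE.
  apply: emeasurable_funB => //.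
  apply: (@measurable_pker_integral _ _ _ _ _ l (fun p => f p + M%:E)).
    by move=> p; exact: bounded_add_ge0.
  exact: emeasurable_funD.
by right; exists M => x; apply: le_integral_bounded => //; rewrite prob_kernel.
Qed.

Section pker_comp.
Context (R : realType) d1 d2 d3 (X : measurableType d1)
  (Y : measurableType d2) (Z : measurableType d3).
Variables (l : R.-pker X ~> Y) (k : R.-pker (X * Y) ~> Z).

Let mkcomp_setT x : (l \; k) x [set: Z] = 1.
Proof.
rewrite /= /mkcomp /kcomp; under eq_integral do rewrite prob_kernel.
by rewrite integral_cst// prob_kernel mule1.
Qed.

HB.instance Definition _ :=
  Kernel_isProbability.Build _ _ X Z R (l \; k) mkcomp_setT.

End pker_comp.

Lemma integral_pker_comp (R : realType) d1 d2 d3 (X : measurableType d1)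
    (Y : measurableType d2) (Z : measurableType d3)
    (l : R.-pker X ~> Y) (k : R.-pker (X * Y) ~> Z) x (f : Z -> \bar R) :
  admissible f -> \int[mkcomp l k x]_z f z = \int[l x]_y \int[k (x, y)]_z f z.
Proof.
move=> [mf [f0|[M fM]]]; first exact: integral_kcomp.
have : \int[mkcomp l k x]_z (f z + M%:E) =
    \int[l x]_y \int[k (x, y)]_z (f z + M%:E).
  apply: (@integral_kcomp _ _ _ _ _ _ _ l k x (fun z => f z + M%:E)).
    by move=> z; exact: bounded_add_ge0.
  exact: emeasurable_funD.
rewrite (@integral_add_cst _ _ _ _ _ M) ?prob_kernel//.
under [RHS]eq_integral do rewrite (@integral_add_cst _ _ _ _ _ M) ?prob_kernel//.
rewrite (@integral_add_cst _ _ _ _ _ M) ?prob_kernel//.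
- by move/(congr1 (fun u => u - M%:E)); rewrite !addeK.
- have af : admissible (fun p : X * Y * Z => f p.2).
    by split; [exact: measurableT_comp|right; exists M => p].
  have := (admissible_integral k af).1.
  move=> h; exact: (measurableT_comp h (measurable_pair1 x)).
- by move=> y; apply: le_integral_bounded => //; rewrite prob_kernel.
Qed.

Lemma admissible_comp (R : realType) d1 d2 (X : measurableType d1)
    (Y : measurableType d2) (f : Y -> \bar R) (u : X -> Y) :
  measurable_fun [set: X] u -> admissible f -> admissible (fun x => f (u x)).
Proof.
move=> mu [mf fb]; split; first exact: measurableT_comp.
by case: fb => [f0|[M fM]]; [left|right; exists M].
Qed.

Section kprecomp.
Context (R : realType) d1 d2 d3 (X : measurableType d1)
  (Y : measurableType d2) (Z : measurableType d3).
Variables (k : R.-pker Y ~> Z) (u : X -> Y).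

(** The measurability proof sits in the term so that the kernel structure can be inferred from it. A
    constant [u] gives a kernel that forgets its argument, a projection one that forgets a
    component. *)
Definition kprecomp of measurable_fun [set: X] u :
  X -> {measure set Z -> \bar R} := fun x => k (u x).

Hypothesis mu : measurable_fun [set: X] u.

Let measurable_kprecomp U : measurable U ->
  measurable_fun [set: X] (kprecomp mu ^~ U).
Proof. by move=> mU; exact: (measurableT_comp (measurable_kernel k U mU) mu). Qed.

HB.instance Definition _ :=
  isKernel.Build _ _ X Z R (kprecomp mu) measurable_kprecomp.

Let kprecomp_setT x : kprecomp mu x [set: Z] = 1.
Proof. exact: prob_kernel. Qed.

HB.instance Definition _ :=
  Kernel_isProbability.Build _ _ X Z R (kprecomp mu) kprecomp_setT.

End kprecomp.

(** Composition alone forgets the intermediate point [y]; following [k] by the Dirac kernel at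
    [(y, z)] keeps it. *)
Lemma pker_joint (R : realType) d1 d2 d3 (X : measurableType d1)
    (Y : measurableType d2) (Z : measurableType d3)
    (l : R.-pker X ~> Y) (k : R.-pker (X * Y) ~> Z) :
  exists m : R.-pker X ~> (Y * Z)%type, forall x (f : Y * Z -> \bar R),
    admissible f -> \int[m x]_p f p = \int[l x]_y \int[k (x, y)]_z f (y, z).
Proof.
have mpair : measurable_fun [set: X * Y * Z] (fun p => (p.1.2, p.2)).
  apply: measurable_fun_pair => //; exact: measurableT_comp.
pose r : R.-pker (X * Y * Z) ~> (Y * Z)%type := kdirac mpair.
exists (mkcomp l (mkcomp k r)) => x f af.
rewrite integral_pker_comp//; apply: eq_integral => y _.
rewrite integral_pker_comp//; apply: eq_integral => z _.
by rewrite /r /kdirac integral_dirac//; [rewrite diracT mul1e|exact: af.1].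
Qed.

(** * Exchange and domination of integrals *)

Section probability_of_measure.
Context (R : realType) d (T : measurableType d) (P : {measure set T -> \bar R}).

(** A copy of [P] that carries a probability structure: kernels take values in bare measures,
    whereas the exchange of integrals asks for sigma-finite ones. *)
Definition probability_of of P [set: T] = 1 : set T -> \bar R := P.

Hypothesis P1 : P [set: T] = 1.

HB.instance Definition _ := isMeasure.Build _ _ _ (probability_of P1)
  (measure0 P) (measure_ge0 P) (@measure_semi_sigma_additive _ _ _ P).

HB.instance Definition _ :=
  Measure_isProbability.Build _ _ _ (probability_of P1) P1.

End probability_of_measure.

Lemma probability_fubini (R : realType) d1 d2 (X : measurableType d1)
    (Y : measurableType d2) (P : {measure set X -> \bar R})
    (Q : {measure set Y -> \bar R}) (f : X * Y -> \bar R) :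
  P [set: X] = 1 -> Q [set: Y] = 1 ->
  (forall p, 0 <= f p) -> measurable_fun [set: X * Y] f ->
  \int[P]_x \int[Q]_y f (x, y) = \int[Q]_y \int[P]_x f (x, y).
Proof.
move=> P1 Q1 f0 mf.
exact: (@fubini_tonelli _ _ _ _ _ (probability_of P1) (probability_of Q1)).
Qed.

(** Passes from sets to nonnegative integrands; with [c] an exponential this is the integrated form
    of differential privacy. *)
Lemma ge0_le_integral_scale (R : realType) d (T : measurableType d)
    (P Q : {measure set T -> \bar R}) (c : {nonneg R}) (f : T -> \bar R) :
  (forall S, measurable S -> P S <= c%:num%:E * Q S) ->
  (forall t, 0 <= f t) -> measurable_fun [set: T] f ->
  \int[P]_t f t <= c%:num%:E * \int[Q]_t f t.
Proof.
move=> PQ f0 mf; rewrite -ge0_integral_mscale//.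
by apply: ge0_le_measure_integral => // S mS _; exact: PQ.
Qed.

(** * Kernel representation of the sampling tree *)

(* Replaces a sigma-algebra on seq Z. *)
Definition measurable_leaves (R : realType) dT dZ (T : measurableType dT)
    (Z : measurableType dZ) (ls : T -> seq Z) :=
  forall dY (Y : measurableType dY) (g : Y * Z -> \bar R),
    (forall p, 0 <= g p) -> measurable_fun [set: Y * Z] g ->
    measurable_fun [set: Y * T] (fun p => \sum_(z <- ls p.2) g (p.1, z)).

Lemma measurable_sum_leaves (R : realType) dT dZ dV dY (T : measurableType dT)
    (Z : measurableType dZ) (V : measurableType dV) (Y : measurableType dY)
    (ls : T -> seq Z) (u : V -> Y) (v : V -> T) (g : Y * Z -> \bar R) :
  measurable_leaves R ls ->
  measurable_fun [set: V] u -> measurable_fun [set: V] v ->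
  (forall p, 0 <= g p) -> measurable_fun [set: Y * Z] g ->
  measurable_fun [set: V] (fun p => \sum_(z <- ls (v p)) g (u p, z)).
Proof.
move=> hls mu mv g0 mg.
exact: (measurableT_comp (hls _ _ g g0 mg) (measurable_fun_pair mu mv)).
Qed.

(** * The children of a node *)

Section Children.
Context (R : realType) (dZ dH : measure_display)
  (Z : measurableType dZ) (H : measurableType dH).

(* The inner recursion of [subtree], with the law of one child abstracted as I; the
   recursive call must sit under I for the two to be convertible. *)
Definition children (I : (seq Z -> H -> \bar R) -> \bar R) :=
  fix children (m : nat) : (seq Z -> m.-tuple H -> \bar R) -> \bar R :=
    match m return (seq Z -> m.-tuple H -> \bar R) -> \bar R with
    | 0 => fun f => f [::] [tuple]
    | m'.+1 => fun f => I (fun ls w =>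
        children m' (fun ls' t => f (ls ++ ls') [tuple of w :: t]))
    end.

(** The operator [I x] is an expectation in continuation form; here it becomes an integral against a
    law on [T], whose points determine the leaves and the output. Admissibility is asked of the
    composite, since no sigma-algebra is put on [seq Z]. *)
Definition represents dX dT (X : measurableType dX) (T : measurableType dT)
    (A : Type) (I : X -> (seq Z -> A -> \bar R) -> \bar R)
    (P : R.-pker X ~> T) (ls : T -> seq Z) (w : T -> A) :=
  forall x cont, admissible (fun t => cont (ls t) (w t)) ->
    I x cont = \int[P x]_t cont (ls t) (w t).

(* The form in which differential privacy of an aggregation kernel is inherited by
   integrals against it. *)
Definition coord_stable m (c : R) (g : m.-tuple H * Z -> \bar R) :=
  forall (t t' : m.-tuple H) (i : 'I_m),
    (forall j, j != i -> tnth t j = tnth t' j) ->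
    forall z, g (t, z) <= c%:E * g (t', z).

Lemma measurable_tuple_cons dV (V : measurableType dV) m (u : V -> H)
    (v : V -> m.-tuple H) :
  measurable_fun [set: V] u -> measurable_fun [set: V] v ->
  measurable_fun [set: V] (fun p => [tuple of u p :: v p]).
Proof. exact: measurable_cons. Qed.

Section children_model.
Context dX dT (X : measurableType dX) (T : measurableType dT).
Variables (I : X -> (seq Z -> H -> \bar R) -> \bar R) (P : R.-pker X ~> T)
  (ls : T -> seq Z) (w : T -> H) (Dn : R.-pker X ~> Z) (N : nat) (a c : R).
Hypotheses (mls : measurable_leaves R ls) (sls : forall t, size (ls t) = N)
  (mw : measurable_fun [set: T] w) (IP : represents I P ls w)
  (a0 : (0 <= a)%R) (c0 : (0 <= c)%R).
Hypothesis one_child : forall x (g : H * Z -> \bar R),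
  (forall p, 0 <= g p) -> measurable_fun [set: H * Z] g ->
  (forall h h' z, g (h, z) <= c%:E * g (h', z)) ->
  a%:E * \int[P x]_t \int[Dn x]_z g (w t, z) <=
  \int[P x]_t \sum_(z <- ls t) g (w t, z).

(** Induction on the number of children. The leaves split into those of the first child, where the
    other children are averaged out and [one_child] applies, and the rest, where the first output is
    frozen and the induction hypothesis applies. *)
Lemma children_model m :
  exists dB (B : measurableType dB) (ls' : B -> seq Z) (ws : B -> m.-tuple H)
    (Q : R.-pker X ~> B),
  [/\ measurable_leaves R ls', forall b, size (ls' b) = (m * N)%N,
      measurable_fun [set: B] ws,
      represents (fun x => @children (I x) m) Q ls' ws &
      forall x (g : m.-tuple H * Z -> \bar R),
        (forall p, 0 <= g p) -> measurable_fun [set: m.-tuple H * Z] g ->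
        coord_stable c g ->
        (m%:R * a)%:E * \int[Q x]_b \int[Dn x]_z g (ws b, z) <=
        \int[Q x]_b \sum_(z <- ls' b) g (ws b, z)].
Proof.
elim: m => [|m [dB [B [ls' [ws [Q [mls' sls' mws IQ IH]]]]]]].
  have mtt : measurable_fun [set: X] (fun=> tt) by exact: measurable_cst.
  exists _, unit, (fun=> [::]), (fun=> [tuple]), (kdirac mtt); split => //.
  - move=> dY Y g g0 mg; under eq_fun do rewrite big_nil.
    exact: measurable_cst.
  - move=> x f [mf _] /=.
    by rewrite /kdirac integral_dirac// diracT mul1e.
  - move=> x g g0 _ _; rewrite mul0r mul0e; apply: integral_ge0 => b _.
    by rewrite big_nil.
(* Given [x], the other children are independent of the first: [Q] is precomposed with the
   projection that drops [t]. *)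
have [J JE] := pker_joint P (kprecomp Q (@measurable_fst _ _ X T)).
exists _, (T * B)%type, (fun p => ls p.1 ++ ls' p.2),
  (fun p => [tuple of w p.1 :: ws p.2]), J; split.
- move=> dY Y g g0 mg.
  under eq_fun do rewrite big_cat.
  apply: emeasurable_funD; apply: measurable_sum_leaves => //;
    exact: measurableT_comp.
- by move=> p; rewrite size_cat sls sls' mulSn.
- by apply: measurable_tuple_cons; exact: measurableT_comp.
- move=> x f af.
  have E t : @children (I x) m (fun s (b : m.-tuple H) =>
        f (ls t ++ s) [tuple of w t :: b]) =
      \int[Q x]_b f (ls t ++ ls' b) [tuple of w t :: ws b].
    rewrite (IQ x (fun s b => f (ls t ++ s) [tuple of w t :: b]))//.
    exact: (admissible_comp (measurable_pair1 t) af).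
  rewrite /= IP /=.
    under eq_integral do rewrite E.
    by rewrite JE.
  rewrite (_ : (fun t => _) = (fun t =>
    \int[kprecomp Q (measurable_cst x) t]_b f (ls t ++ ls' b) [tuple of w t :: ws b])).
    exact: admissible_integral af.
  by apply/funext => t; rewrite E.
move=> x g g0 mg gc.
(* Kernels constant in their argument: they give measurability, in the remaining parameter, of
   integrals against the fixed laws [Q x] and [Dn x]. *)
pose kT : R.-pker T ~> B := kprecomp Q (measurable_cst x).
pose kZ : R.-pker (T * B)%type ~> Z := kprecomp Dn (measurable_cst x).
pose kHZ : R.-pker (H * Z)%type ~> B := kprecomp Q (measurable_cst x).
have P1 : P x [set: T] = 1 by exact: prob_kernel.
have Q1 : Q x [set: B] = 1 by exact: prob_kernel.
have D1 : Dn x [set: Z] = 1 by exact: prob_kernel.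
pose G (p : T * B * Z) := g ([tuple of w p.1.1 :: ws p.1.2], p.2).
have mG : measurable_fun [set: T * B * Z] G.
  apply: (measurableT_comp mg); apply: measurable_fun_pair => //.
  by apply: measurable_tuple_cons; do 2 apply: measurableT_comp => //.
have G0 p : 0 <= G p by exact: g0.
have mDG : measurable_fun [set: T * B] (fun p => \int[Dn x]_z G (p, z)).
  exact: (measurable_pker_integral kZ).
have DG0 p : 0 <= \int[Dn x]_z G (p, z) by apply: integral_ge0.
pose S1 (p : T * B) := \sum_(z <- ls p.1) G (p, z).
pose S2 (p : T * B) := \sum_(z <- ls' p.2) G (p, z).
have mS1 : measurable_fun [set: T * B] S1 by exact: measurable_sum_leaves.
have mS2 : measurable_fun [set: T * B] S2 by exact: measurable_sum_leaves.
have S10 p : 0 <= S1 p by exact: sume_ge0.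
have S20 p : 0 <= S2 p by exact: sume_ge0.
rewrite JE; last by split; [exact: mDG|left => p; exact: DG0].
have SE : (fun p : T * B => \sum_(z <- ls p.1 ++ ls' p.2)
    g ([tuple of w p.1 :: ws p.2], z)) = (fun p => S1 p + S2 p).
  by apply/funext => p; rewrite big_cat.
rewrite SE JE; last first.
  by split; [exact: emeasurable_funD|left => p; exact: adde_ge0].
have mtb (F : T * B -> \bar R) t : measurable_fun [set: T * B] F ->
    measurable_fun [set: B] (fun b => F (t, b)).
  by move=> mF; exact: measurableT_comp.
have mQS1 := measurable_pker_integral kT S10 mS1.
have mQS2 := measurable_pker_integral kT S20 mS2.
have mQD := measurable_pker_integral kT DG0 mDG.
have -> : \int[P x]_t \int[Q x]_b (S1 (t, b) + S2 (t, b)) =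
    \int[P x]_t \int[Q x]_b S1 (t, b) + \int[P x]_t \int[Q x]_b S2 (t, b).
  rewrite -ge0_integralD//; last 2 first.
  - by move=> t _; exact: integral_ge0.
  - by move=> t _; exact: integral_ge0.
  apply: eq_integral => t _; rewrite ge0_integralD//; exact: mtb.
(* The factor [(m + 1) * a] splits into [a] for the first child and [m * a] for the others. *)
rewrite -natr1 mulrDl mul1r addrC EFinD ge0_muleDl ?lee_fin ?mulr_ge0//.
apply: leeD.
  (* Averaging over the other children keeps the stability in the first coordinate, which is what
     [one_child] asks for. *)
  pose g' (p : H * Z) := \int[Q x]_b g ([tuple of p.1 :: ws b], p.2).
  have mcons : measurable_fun [set: H * Z * B]
      (fun p => g ([tuple of p.1.1 :: ws p.2], p.1.2)).
    apply: (measurableT_comp mg); apply: measurable_fun_pair => //; last first.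
      exact: measurableT_comp.
    apply: measurable_tuple_cons; exact: measurableT_comp.
  have mb p : measurable_fun [set: B] (fun b => g ([tuple of p.1 :: ws b], p.2)).
    exact: (measurableT_comp mcons (measurable_pair1 p)).
  have mg' : measurable_fun [set: H * Z] g'.
    exact: (measurable_pker_integral kHZ _ mcons).
  have g'0 p : 0 <= g' p by exact: integral_ge0.
  have g'c h h' z : g' (h, z) <= c%:E * g' (h', z).
    rewrite -ge0_integralZl//.
    apply: ge0_le_integral => //.
      exact: measurable_funeM (mb (h', z)).
    move=> b _; apply: (gc _ _ ord0) => j.
    by case: (unliftP ord0 j) => [i ->|->]; rewrite ?eqxx// !tnthS.
  have -> : \int[P x]_t \int[Q x]_b S1 (t, b) =
      \int[P x]_t \sum_(z <- ls t) g' (w t, z).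
    apply: eq_integral => t _; rewrite /g' /S1 /= ge0_integral_sum//.
    by move=> z; exact: (mb (w t, z)).
  have -> : \int[P x]_t \int[Q x]_b \int[Dn x]_z G (t, b, z) =
      \int[P x]_t \int[Dn x]_z g' (w t, z).
    apply: eq_integral => t _; rewrite /g' /=; apply/esym.
    rewrite (@probability_fubini _ _ _ _ _ (Dn x) (Q x)
      (fun p => g ([tuple of w t :: ws p.2], p.1)))//.
    apply: (measurableT_comp mg); apply: measurable_fun_pair => //.
    by apply: measurable_tuple_cons => //; exact: measurableT_comp.
  exact: one_child.
rewrite -ge0_integralZl//; last 2 first.
- by move=> t _; apply: integral_ge0 => b _; exact: DG0.
- by rewrite lee_fin mulr_ge0.
apply: ge0_le_integral => //.
- by move=> t _; apply: mule_ge0; [rewrite lee_fin mulr_ge0|apply: integral_ge0 => b _; exact: DG0].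
  exact: measurable_funeM mQD.
move=> t _.
(* Fixing the first output shifts coordinates: position [i] of the tail is position [lift ord0 i] of
   the full tuple. *)
apply: (IH x (fun p => g ([tuple of w t :: p.1], p.2))) => //.
  apply: (measurableT_comp mg); apply: measurable_fun_pair => //.
  by apply: measurable_tuple_cons.
move=> s s' i ss' z; apply: (gc _ _ (lift ord0 i)) => j.
case: (unliftP ord0 j) => [j' ->|->]; last by rewrite !tnth0.
by rewrite (inj_eq lift_inj) !tnthS; exact: ss'.
Qed.
End children_model.
End Children.

(** * The induction invariant, at a leaf and at an inner node *)

Section SubtreeModel.
Context (R : realType) (dZ dH : measure_display)
  (Z : measurableType dZ) (H : measurableType dH).

(** The induction invariant at a node with value [x]: [P x] is the law of its subtree, [Dn x] that
    of a fresh point drawn below the same node. As [g] is an arbitrary nonnegative function, the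
    aggregations above the node can be absorbed in it. The sample space [T] is existential because
    it changes with the level. *)
Definition subtree_model dX (X : measurableType dX)
    (I : X -> (seq Z -> H -> \bar R) -> \bar R) (D : X -> (Z -> \bar R) -> \bar R)
    (N : nat) (a : R) :=
  exists dT (T : measurableType dT) (ls : T -> seq Z) (w : T -> H)
    (P : R.-pker X ~> T) (Dn : R.-pker X ~> Z),
  [/\ measurable_leaves R ls, forall t, size (ls t) = N,
      measurable_fun [set: T] w, represents I P ls w &
      (forall x f, admissible f -> D x f = \int[Dn x]_z f z) /\
      forall x (g : H * Z -> \bar R),
        (forall p, 0 <= g p) -> measurable_fun [set: H * Z] g ->
        a%:E * \int[P x]_t \int[Dn x]_z g (w t, z) <=
        \int[P x]_t \sum_(z <- ls t) g (w t, z)].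

(** A fresh draw from a data point is that point itself, so both sides agree with [N = a = 1]. *)
Lemma subtree_model_leaf (emb : Z -> H) : measurable_fun [set: Z] emb ->
  subtree_model (fun z cont => cont [:: z] (emb z)) (fun z f => f z) 1 1.
Proof.
move=> memb.
pose d : R.-pker Z ~> Z := kdirac (@measurable_id _ Z setT).
exists _, Z, (fun z => [:: z]), emb, d, d.
split => //.
- by move=> dY Y g g0 mg; under eq_fun do rewrite big_seq1 -surjective_pairing.
- by move=> z f [mf _]; rewrite /kdirac integral_dirac// diracT mul1e.
split; first by move=> z f [mf _]; rewrite /kdirac integral_dirac// diracT mul1e.
move=> x g g0 mg; rewrite mul1e /kdirac integral_dirac; first 1 last => //.
  apply: (@measurable_pker_integral R _ _ Z Z (kdirac (measurable_cst x))
    (fun p => g (emb p.1, p.2))) => //.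
  apply: (measurableT_comp mg); apply: measurable_fun_pair => //.
  exact: measurableT_comp.
rewrite diracT mul1e integral_dirac//; last first.
  exact: (measurableT_comp mg (measurable_pair1 _)).
rewrite diracT mul1e integral_dirac//; first by rewrite diracT mul1e big_seq1.
under eq_fun do rewrite big_seq1.
by apply: (measurableT_comp mg); exact: measurable_fun_pair.
Qed.

(** The invariant of the children compares a subtree with a fresh point below the same child.
    Letting the fresh point come from an independent child costs [expR (- e)], because the aggregate
    reacts to one input by a factor of at most [expR e]. *)
Lemma subtree_model_node dC (C : measurableType dC)
    (I : C -> (seq Z -> H -> \bar R) -> \bar R) (D : C -> (Z -> \bar R) -> \bar R)
    (N n : nat) (a e : R) (K : n.-tuple H -> pprobability H R) :
  subtree_model I D N a -> (0 <= a)%R ->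
  measurable_fun [set: n.-tuple H] K -> kernel_DP K e ->
  @subtree_model _ (pprobability C R)
    (fun nu cont => @children _ _ _ Z H (fun f => \int[nu]_c I c f) n
       (fun ls (ws : n.-tuple H) => \int[K ws]_h cont ls h))
    (fun nu f => \int[nu]_c D c f) (n * N) (n%:R * (a * expR (- e))).
Proof.
move=> [dT [T [ls [w [P [Dn [mls sls mw IP [DE MI]]]]]]]] a0 mK KDP.
pose X : measurableType _ := pprobability C R.
(* Each of [P1 nu] and [D1 nu] draws its own child from [nu], so that iterated integration makes the
   fresh point independent of the subtree. *)
pose idC : R.-pker X ~> C := kprobability (@measurable_id _ X setT).
pose P1 : R.-pker X ~> T := mkcomp idC (kprecomp P measurable_snd).
pose D1 : R.-pker X ~> Z := mkcomp idC (kprecomp Dn measurable_snd).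
have P1E nu f : admissible f ->
    \int[P1 nu]_t f t = \int[(nu : probability C R)]_c \int[P c]_t f t.
  by move=> af; rewrite integral_pker_comp.
have D1E nu f : admissible f ->
    \int[D1 nu]_z f z = \int[(nu : probability C R)]_c \int[Dn c]_z f z.
  by move=> af; rewrite integral_pker_comp.
have IP1 : represents (fun (nu : X) f => \int[(nu : probability C R)]_c I c f) P1 ls w.
  by move=> nu f af; rewrite P1E//; apply: eq_integral => c _; exact: IP.
have e0 : (0 <= expR e)%R by exact: expR_ge0.
have one_child (nu : probability C R) (g : H * Z -> \bar R) : (forall p, 0 <= g p) ->
    measurable_fun [set: H * Z] g ->
    (forall h h' z, g (h, z) <= (expR e)%:E * g (h', z)) ->
    (a * expR (- e))%:E * \int[P1 nu]_t \int[D1 nu]_z g (w t, z) <=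
    \int[P1 nu]_t \sum_(z <- ls t) g (w t, z).
  move=> g0 mg gc.
  pose kD : R.-pker (C * T)%type ~> Z := kprecomp Dn measurable_fst.
  have mgw : measurable_fun [set: C * T * Z] (fun p => g (w p.1.2, p.2)).
    apply: (measurableT_comp mg); apply: measurable_fun_pair => //.
    by do 2 apply: measurableT_comp => //.
  pose F (p : C * T) := \int[Dn p.1]_z g (w p.2, z).
  have mF : measurable_fun [set: C * T] F.
    exact: (measurable_pker_integral kD _ mgw).
  have F0 p : 0 <= F p by exact: integral_ge0.
  have mFc c : measurable_fun [set: T] (fun t => F (c, t)).
    exact: measurableT_comp.
  have mS : measurable_fun [set: T] (fun t => \sum_(z <- ls t) g (w t, z)).
    exact: measurable_sum_leaves.
  rewrite [leRHS]P1E; last by split => //; left => t; exact: sume_ge0.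
  (* c plays the fresh child and t the hypothesis of an independent one. *)
  have -> : \int[P1 nu]_t \int[D1 nu]_z g (w t, z) =
      \int[nu]_c \int[P1 nu]_t F (c, t).
    rewrite (probability_fubini (probability_setT nu) (prob_kernel (s := P1) nu) F0 mF).
    apply: eq_integral => t _; rewrite D1E//; split; last by left.
    exact: measurableT_comp.
  have mPF : measurable_fun [set: C] (fun c => \int[P1 nu]_t F (c, t)).
    pose k1 : R.-pker C ~> T := kprecomp P1 (@measurable_cst _ _ C X setT nu).
    exact: (measurable_pker_integral k1 F0 mF).
  rewrite -ge0_integralZl//; last 2 first.
  - by move=> c _; exact: integral_ge0.
  - by rewrite lee_fin mulr_ge0 ?expR_ge0.
  apply: ge0_le_integral => //.
  - move=> c _; rewrite mule_ge0 ?integral_ge0//.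
    by rewrite lee_fin mulr_ge0 ?expR_ge0.
  - exact: measurable_funeM mPF.
  - apply: (@measurable_pker_integral _ _ _ _ _ P
      (fun p => \sum_(z <- ls p.2) g (w p.2, z))).
      by move=> p; exact: sume_ge0.
    exact: (measurableT_comp mS).
  (* For fixed [c], [MI] treats the subtree and the fresh point below the same child; it remains to
     replace the law [P1 nu] of [t] by [P c]. *)
  move=> c _; apply: le_trans (MI c g g0 mg).
  rewrite EFinM -muleA; apply: lee_wpmul2l; first by rewrite lee_fin.
  (* F (c, _) varies by a factor at most e^e, so the law of t may be changed. *)
  set V := \int[P1 nu]_t F (c, t).
  have VF t : (expR (- e))%:E * V <= F (c, t).
    have : V <= (expR e)%:E * F (c, t).
      rewrite -[leRHS]mule1 -(prob_kernel (s := P1) nu) -integral_cst//.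
      apply: ge0_le_integral => // t' _; rewrite /F /= -ge0_integralZl//; last first.
        exact: (measurableT_comp mg (measurable_pair1 _)).
      apply: ge0_le_integral => //.
      - exact: (measurableT_comp mg (measurable_pair1 _)).
      - exact: measurable_funeM (measurableT_comp mg (measurable_pair1 _)).
    move/(lee_wpmul2l (expR_ge0 (- e) : 0 <= (expR (- e))%:E)).
    by rewrite muleA -EFinM -expRD addNr expR0 mul1e.
  rewrite -[leLHS]mule1 -(prob_kernel (s := P) c) -integral_cst//.
  apply: ge0_le_integral => //; last by move=> t _; exact: VF.
    by move=> t _; rewrite mule_ge0 ?lee_fin ?expR_ge0// integral_ge0.
  exact: mFc.
have ae0 : (0 <= a * expR (- e))%R by rewrite mulr_ge0 ?expR_ge0.
have [dB [B [ls' [ws [Q [mls' sls' mws IQ MI']]]]]] :=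
  children_model mls sls mw IP1 ae0 e0 one_child n.
pose kK : R.-pker (n.-tuple H) ~> H := kprobability mK.
have mws2 : measurable_fun [set: X * B] (fun p => ws p.2).
  exact: measurableT_comp.
have [J JE] := pker_joint Q (kprecomp kK mws2).
exists _, (B * H)%type, (fun p => ls' p.1), snd, J, D1; split => //.
- by move=> dY Y g g0 mg; apply: measurable_sum_leaves => //; exact: measurableT_comp.
- move=> nu f af.
  rewrite IQ/=; first by rewrite JE.
  exact: (admissible_integral (kprecomp kK mws) af).
split; first by move=> nu f af; rewrite D1E//; apply: eq_integral => c _; exact: DE.
move=> nu g g0 mg.
pose kK' : R.-pker (n.-tuple H * Z)%type ~> H := kprecomp kK measurable_fst.
have mgs : measurable_fun [set: n.-tuple H * Z * H] (fun q => g (q.2, q.1.2)).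
  apply: (measurableT_comp mg); apply: measurable_fun_pair => //.
  exact: measurableT_comp.
(* The randomness of the aggregation moves into the integrand: [g'] depends on the outputs of the
   children, and differential privacy becomes its coordinate stability. *)
pose g' (p : n.-tuple H * Z) := \int[K p.1]_h g (h, p.2).
have mg' : measurable_fun [set: n.-tuple H * Z] g'.
  exact: (measurable_pker_integral kK' _ mgs).
have g'0 p : 0 <= g' p by exact: integral_ge0.
have mgz z : measurable_fun [set: H] (fun h => g (h, z)).
  exact: (measurableT_comp mg (measurable_pair2 z)).
have g'e : coord_stable (expR e) g'.
  move=> t t' i tt' z.
  exact: (@ge0_le_integral_scale _ _ _ _ _ (NngNum e0) _ (KDP _ _ _ tt')).
have -> : \int[J nu]_p \int[D1 nu]_z g (p.2, z) =
    \int[Q nu]_b \int[D1 nu]_z g' (ws b, z).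
  rewrite JE; last first.
    split; last by left => p; exact: integral_ge0.
    apply: (@measurable_pker_integral _ _ _ _ _ (kprecomp D1 (measurable_cst nu))
      (fun q : B * H * Z => g (q.1.2, q.2))) => //.
    apply: (measurableT_comp mg); apply: measurable_fun_pair => //.
    exact: measurableT_comp.
  apply: eq_integral => b _.
  by rewrite (@probability_fubini _ _ _ _ _ _ _ g) ?prob_kernel ?probability_setT.
have -> : \int[J nu]_p \sum_(z <- ls' p.1) g (p.2, z) =
    \int[Q nu]_b \sum_(z <- ls' b) g' (ws b, z).
  rewrite JE; last first.
    split; first exact: measurable_sum_leaves.
    by left => p; exact: sume_ge0.
  apply: eq_integral => b _; rewrite /= ge0_integral_sum//.
exact: MI'.
Qed.
End SubtreeModel.

(** * The generalization bound *)

(** Induction on the height [k]: the node has depth [L - k] and its invariant gathers the levels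
    below it, so a leaf has an empty product and an empty sum. *)
Lemma subtree_modelP (R : realType) (dZ dH : measure_display)
    (Z : measurableType dZ) (H : measurableType dH) (L : nat) (n : nat -> nat)
    (emb : Z -> H) (K : forall l : nat, (n l).-tuple H -> pprobability H R)
    (eps : nat -> R) :
  measurable_fun [set: Z] emb ->
  (forall l, (1 <= l <= L)%N -> measurable_fun [set: (n l).-tuple H] (K l)) ->
  (forall l, (1 <= l <= L)%N -> kernel_DP (K l) (eps l)) ->
  forall k, (k <= L)%N ->
  subtree_model (@subtree R dZ dH Z H L n K emb k) (@Defs.down R dZ Z k)
    (\prod_((L - k).+1 <= l < L.+1) n l)
    ((\prod_((L - k).+1 <= l < L.+1) n l)%:R *
      expR (- \sum_((L - k).+1 <= l < L.+1) eps l))%R.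
Proof.
move=> memb mK KDP; elim=> [_|k IH kL].
  rewrite subn0 !big_geq// oppr0 expR0 mulr1.
  exact: subtree_model_leaf.
have Lk : (1 <= L - k <= L)%N by rewrite subn_gt0 kL leq_subr.
(* A node of height [k.+1] aggregates outputs of depth [L - k], so the step adds exactly the index
   [L - k] in front of both ranges. *)
have kE : ((L - k.+1).+1 = L - k)%N by rewrite subnS prednK// subn_gt0.
have kL' : (L - k < L.+1)%N by rewrite ltnS leq_subr.
rewrite kE.
rewrite (big_ltn kL') (big_ltn (F := eps) kL').
set N := (\prod_(_.+1 <= i < _) n i)%N.
set s := (\sum_(_.+1 <= i < _) eps i)%R.
have -> : ((n (L - k)%N * N)%N%:R * expR (- (eps (L - k)%N + s)) =
    (n (L - k)%N)%:R * (N%:R * expR (- s) * expR (- eps (L - k)%N)) :> R)%R.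
  by rewrite natrM opprD expRD -!mulrA [(expR _ * expR _)%R]mulrC.
have := subtree_model_node (IH (ltnW kL)) _ (mK _ Lk) (KDP _ Lk).
apply; by rewrite mulr_ge0 ?expR_ge0.
Qed.

(** * Elementary inequalities *)

Lemma one_sub_expR_le (R : realType) (s b : R) :
  (Num.min 1 s <= b -> 1 - expR (- s) <= b)%R.
Proof.
have := expR_ge1Dx (- s); have := expR_ge0 (- s) => h1 h2.
by rewrite ge_min => /orP[] ?; lra.
Qed.

(** For [e > 0] compare squares: that of [Num.min 1 e] is at most [1 * e] and, since
    [expR e - 1 >= e], at most [e * (expR e - 1)]. For [e <= 0] the left side is at most [0]. *)
Lemma min1_le_sqrt (R : realType) (e : R) :
  (Num.min 1 e <= Num.sqrt (Num.min e (e * (expR e - 1))))%R.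
Proof.
have [e0|e0] := lerP e 0%R.
  by rewrite ge_min; apply/orP; right; rewrite (le_trans e0)// sqrtr_ge0.
have m0 : (0 <= Num.min 1 e)%R by rewrite le_min ler01 ltW.
have h := expR_ge1Dx e.
have m1 : (Num.min 1 e <= 1)%R by rewrite ge_min lexx.
have me : (Num.min 1 e <= e)%R by rewrite ge_min lexx orbT.
rewrite -[leLHS]ger0_norm// -sqrtr_sqr; apply: ler_wsqrtr.
rewrite le_min expr2; apply/andP; split.
  by rewrite (le_trans _ me)// ler_piMl.
by rewrite ler_pM//; lra.
Qed.

(** Truncation at [1] is subadditive for nonnegative bounds: either one bound reaches [1], or both
    dominate the untruncated terms and can be added. *)
Lemma min1_sum_le_sqrt (R : realType) (eps : nat -> R) (r : seq nat) :
  (Num.min 1 (\sum_(l <- r) eps l) <=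
    \sum_(l <- r) Num.sqrt (Num.min (eps l) (eps l * (expR (eps l) - 1))))%R.
Proof.
elim: r => [|l r IH]; first by rewrite !big_nil ge_min lexx orbT.
rewrite !big_cons.
have h := min1_le_sqrt (eps l).
have h0 : (0 <= Num.sqrt (Num.min (eps l) (eps l * (expR (eps l) - 1))))%R.
  exact: sqrtr_ge0.
have h1 : (0 <= \sum_(j <- r) Num.sqrt (Num.min (eps j) (eps j * (expR (eps j) - 1))))%R.
  by apply: sumr_ge0 => j _; exact: sqrtr_ge0.
move: h IH; rewrite !ge_min => /orP[h|h] /orP[h'|h']; apply/orP; lra.
Qed.

(* From the invariant at the root to the bound on [gen] *)
Local Close Scope ereal_scope.

Theorem theorem2 (R : realType) (dZ dH : measure_display)
  (Z : measurableType dZ) (H : measurableType dH)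
  (L : nat) (n : nat -> nat)
  (D : LevT R Z L)
  (emb : Z -> H) (loss : H -> Z -> R)
  (K : forall l : nat, (n l).-tuple H -> pprobability H R)
  (eps : nat -> R) :
  (0 < L)%N ->
  (forall l, (1 <= l <= L)%N -> (0 < n l)%N) ->
  measurable_fun [set: Z] emb ->
  measurable_fun [set: H * Z] (fun p => loss p.1 p.2) ->
  (forall w z, 0 <= loss w z <= 1) ->
  (forall l, (1 <= l <= L)%N -> measurable_fun [set: (n l).-tuple H] (K l)) ->
  (forall l, (1 <= l <= L)%N -> kernel_DP (K l) (eps l)) ->
  (gen K emb D loss <=
     (2 * \sum_(1 <= l < L.+1)
            Num.sqrt (Num.min (eps l) (eps l * (expR (eps l) - 1))))%:E)%E.
Proof.
move=> _ n_gt0 memb mloss loss01 mK KDP.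
have := subtree_modelP memb mK KDP (leqnn L).
rewrite subnn -/(Nprod n L).
set N := Nprod n L; set s := (\sum_(1 <= l < L.+1) eps l)%R.
move=> [dT [T [ls [w [P [Dn [mls sls mw IP [DE MI]]]]]]]].
have N_gt0 : (0 < N)%N.
  rewrite /N /Nprod big_nat_cond; apply: prodn_cond_gt0 => l.
  by rewrite andbT ltnS; exact: n_gt0.
have N0 : (0 < N%:R :> R)%R by rewrite ltr0n.
pose g (p : H * Z) : \bar R := (loss p.1 p.2)%:E.
have mg : measurable_fun [set: H * Z] g by exact/measurable_EFinP.
have g0 p : (0 <= g p)%E by rewrite lee_fin; case/andP: (loss01 p.1 p.2).
have g1 p : (g p <= 1)%E by rewrite lee_fin; case/andP: (loss01 p.1 p.2).
have P1 : P D [set: T] = 1%E by exact: prob_kernel.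
have D1 : Dn D [set: Z] = 1%E by exact: prob_kernel.
pose pop t := (\int[Dn D]_z g (w t, z))%E.
pose S t := (\sum_(z <- ls t) g (w t, z))%E.
have mpop : measurable_fun [set: T] pop.
  apply: (@measurable_pker_integral _ _ _ _ _ (kprecomp Dn (measurable_cst D))
    (fun p => g (w p.1, p.2))) => //.
  by apply: (measurableT_comp mg); apply: measurable_fun_pair => //;
    exact: measurableT_comp.
have mS : measurable_fun [set: T] S by exact: measurable_sum_leaves.
have S0 t : (0 <= S t)%E by exact: sume_ge0.
have SN t : (S t <= N%:R%:E)%E.
  rewrite -(sls t) /S; elim: (ls t) => [|z l IH]; first by rewrite big_nil.
  by rewrite big_cons -natr1 addrC EFinD leeD.
have pop0 t : (0 <= pop t)%E by exact: integral_ge0.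
have pop1 t : (pop t <= 1)%E.
  apply: (@le_trans _ _ (\int[Dn D]_z 1)%E).
    apply: ge0_le_integral => //.
    exact: (measurableT_comp mg (measurable_pair1 _)).
  by rewrite integral_cst// D1 mule1.
pose emp t := ((N%:R^-1 : R)%:E * S t)%E.
have empE t : (emprisk L n loss (w t) (ls t))%:E = emp t.
  by rewrite /emp /S sumEFin -EFinM mulrC.
have popE t : poprisk D loss (w t) = pop t.
  rewrite /poprisk DE//; split; last by left => z; exact: (g0 (w t, z)).
  exact: (measurableT_comp mg (measurable_pair1 _)).
have memp : measurable_fun [set: T] emp by exact: measurable_funeM.
have emp0 t : (0 <= emp t)%E by rewrite mule_ge0// lee_fin invr_ge0 ler0n.
have emp1 t : (emp t <= 1)%E.
  rewrite /emp -[leRHS](_ : (N%:R^-1)%:E * N%:R%:E = 1)%E; last first.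
    by rewrite -EFinM mulVf// gt_eqF.
  by apply: lee_wpmul2l => //; rewrite lee_fin invr_ge0 ler0n.
have abs1 (x : \bar R) : (0 <= x -> x <= 1 -> `|x| <= 1%:E)%E.
  by move=> x0 x1; rewrite gee0_abs.
(* Both risks lie in [[0, 1]], so the signed integrand of [gen] is bounded and the representation at
   the root applies. *)
have -> : gen K emb D loss = (\int[P D]_t (pop t - emp t))%E.
  rewrite /gen IP; first by apply: eq_integral => t _; rewrite popE empE.
  rewrite (_ : (fun t => _) = (fun t => pop t - emp t)%E); last first.
    by apply/funext => t; rewrite popE empE.
  split; first exact: emeasurable_funB.
  right; exists (1 + 1)%R => t; rewrite (le_trans (lee_abs_sub _ _))// EFinD.
  by apply: leeD; exact: abs1.
rewrite integralB//; last 2 first.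
- by apply: (@integrable_bounded _ _ _ _ _ 1%R) => // t; exact: abs1.
- by apply: (@integrable_bounded _ _ _ _ _ 1%R) => // t; exact: abs1.
have A0 : (0 <= \int[P D]_t pop t)%E by exact: integral_ge0.
have A1 : (\int[P D]_t pop t <= 1)%E.
  apply: (@le_trans _ _ (\int[P D]_t 1)%E); first exact: ge0_le_integral.
  by rewrite integral_cst// P1 mule1.
(* The invariant at the root, with [g] the loss, divided by the number [N] of leaves. *)
have AB : ((expR (- s))%:E * \int[P D]_t pop t <= \int[P D]_t emp t)%E.
  rewrite ge0_integralZl// ?lee_fin ?invr_ge0//.
  have -> : expR (- s) = (N%:R^-1 * (N%:R * expR (- s)))%R.
    by rewrite mulrA mulVf ?mul1r// gt_eqF.
  rewrite EFinM -muleA; apply: lee_wpmul2l; last exact: MI.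
  by rewrite lee_fin invr_ge0.
move: A0 A1 AB; case: (\int[P D]_t pop t)%E => [A| |]//.
rewrite -EFinM !lee_fin => A0 A1 AB.
apply: (@le_trans _ _ (A - expR (- s) * A)%:E%E).
  by rewrite EFinB; exact: leeB.
rewrite lee_fin.
have := one_sub_expR_le (min1_sum_le_sqrt eps (index_iota 1 L.+1)).
set b := (\sum_(_ <- _) Num.sqrt _)%R; rewrite -/s => sb.
have b0 : (0 <= b)%R by apply: sumr_ge0 => l _; exact: sqrtr_ge0.
have es1 : (0 <= expR (- s))%R by exact: expR_ge0.
(* Since [0 <= A <= 1], [1 - expR (- s) <= b] and [0 <= b], the product [A * (1 - expR (- s))] is at
   most [b], hence at most [2 * b]. *)
nra.
Qed.
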